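(* Let $F:\mathbb{N}^+\times\mathbb{N}^+\to\mathbb{N}^+$ be defined by $$F(m,n)=\frac{1}{4}\left[(m+n-1)^2-\big((m+n-1)\bmod 2\big)\right]+\min(m,n).$$ Let $(x_1,y_1),(x_2,y_2)\in\mathbb{N}^+\times\mathbb{N}^+$ with $(x_1,y_1)\neq(x_2,y_2)$. Then: (1) if $(x_1,y_1)=(y_2,x_2)$, then $F(x_1,y_1)=F(x_2,y_2)$; (2) if $(x_1,y_1)\neq(y_2,x_2)$, then $F(x_1,y_1)\neq F(x_2,y_2)$.
   Context: $\mathbb{N}^+$ denotes the set of positive integers. For an integer $k$, $k\bmod 2$ denotes the least non-negative residue of $k$ modulo $2$. *)

(* Defs.v *)
From mathcomp Require Import all_boot all_order all_algebra.

Set Implicit Arguments.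
Unset Strict Implicit.
Unset Printing Implicit Defensive.

Import GRing.Theory.

Definition posint := {n : nat | 0 < n}.

(* The two truncated subtractions and the division by 4 are exact, as proved
   in FE below, so this is the formula read in the rationals. *)
Definition F_nat (m n : nat) : nat :=
  ((m + n - 1) ^ 2 - (m + n - 1) %% 2) %/ 4 + minn m n.

Lemma F_nat_gt0 (m n : posint) : 0 < F_nat (val m) (val n).
Proof. by rewrite /F_nat addn_gt0 leq_min (valP m) (valP n) orbT. Qed.

Definition F (m n : posint) : posint :=
  exist _ (F_nat (val m) (val n)) (F_nat_gt0 m n).

Lemma dvd4_sqr_sub_mod2 (k : nat) : 4 %| k ^ 2 - k %% 2.
Proof.
have -> : k ^ 2 - k %% 2 = 4 * (k./2 ^ 2 + odd k * k./2).
  rewrite modn2 -{1}(odd_double_half k) sqrnD -mul2n expnMn.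
  case: (odd k); last by rewrite /= exp0n // !mul0n add0n ?muln0 !addn0 ?subn0.
  by rewrite /= exp1n !mul1n -addnA addnC addnK mulnA mulnDr.
by rewrite dvdn_mulr.
Qed.

Lemma mod2_le_sqr (k : nat) : k %% 2 <= k ^ 2.
Proof. by case: k => // k; rewrite (leq_trans (leq_mod _ _)) // leq_pmull. Qed.

Lemma FE (m n : posint) :
  let a := (val m)%:Q%R in let b := (val n)%:Q%R in
  ((val (F m n))%:Q =
   1 / 4 * ((a + b - 1) ^+ 2 - ((val m + val n - 1) %% 2)%N%:Q)
   + (minn (val m) (val n))%:Q)%R.
Proof.
case: m n => [m m0] [n n0] /=.
have mn1 : 0 < m + n by rewrite addn_gt0 m0.
set k := m + n - 1.
have -> : (m%:Q + n%:Q - 1 = k%:Q)%R.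
  by rewrite -!pmulrn /k natrB // natrD.
have := divnK (dvd4_sqr_sub_mod2 k); rewrite /F_nat -/k.
set q := (_ %/ 4) => Eq.
have -> : ((k%:Q) ^+ 2 - (k %% 2)%N%:Q = q%:Q * 4)%R.
  by rewrite -!pmulrn -natrX -natrB ?mod2_le_sqr // -Eq natrM.
by rewrite -!pmulrn natrD mul1r mulrCA mulVf ?mulr1.
Qed.

(* Main.v *)
(* Put g(k) = (k^2 - k mod 2)/4 = floor(k/2) ceil(k/2), so g(k+1) = g(k) + ceil(k/2).
   Since 1 <= min(m,n) <= floor((m+n)/2), the value F(m,n) lies in the
   interval (g(m+n-1), g(m+n)]. These intervals are disjoint for distinct sums,
   so F(m,n) determines m+n, then min(m,n), hence {m,n}. *)
Require Import Defs.
From mathcomp Require Import all_boot all_order all_algebra.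
From mathcomp Require Import zify.

(** With [k = b + 2 * j] and [b] the parity bit, [b ^ 2 = b] makes the numerator exactly
    [4 * (j * (b + j))]. *)
Lemma quarter_sqrE (k : nat) : (k ^ 2 - k %% 2) %/ 4 = k./2 * uphalf k.
Proof.
rewrite uphalf_half -{1 2}(odd_double_half k) -mul2n.
set b := odd k; set j := k./2.
have -> : (b + 2 * j) ^ 2 - (b + 2 * j) %% 2 = 4 * (j * (b + j)).
  by rewrite -mulnn; case: b; nia.
by rewrite mulKn.
Qed.

(** Passing to [k.+1], the old ceiling half becomes the floor half, and the old floor half plus one
    becomes the ceiling half. *)
Lemma half_uphalfS (k : nat) : k.+1./2 * uphalf k.+1 = k./2 * uphalf k + uphalf k.
Proof. by rewrite -uphalfE /= mulnS mulnC addnC. Qed.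

Lemma leq_half_uphalf (k l : nat) : k <= l -> k./2 * uphalf k <= l./2 * uphalf l.
Proof. by move=> kl; rewrite leq_mul ?half_leq ?uphalf_leq. Qed.

Lemma F_natC : commutative F_nat.
Proof. by move=> m n; rewrite /F_nat (addnC m n) minnC. Qed.

Lemma F_natE (m n : nat) :
  F_nat m n = (m + n - 1)./2 * uphalf (m + n - 1) + minn m n.
Proof. by rewrite /F_nat quarter_sqrE. Qed.

Lemma F_nat_lt {m n m' n' : nat} : 0 < m -> 0 < m' -> 0 < n' ->
  m + n < m' + n' -> F_nat m n < F_nat m' n'.
Proof.
move=> m0 m'0 n'0 lt_sum; rewrite !F_natE.
have := half_uphalfS (m + n - 1); rewrite subn1 prednK ?addn_gt0 ?m0 // -subn1.
have : (m + n)./2 * uphalf (m + n)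
       <= (m' + n' - 1)./2 * uphalf (m' + n' - 1).
  by apply: leq_half_uphalf; lia.
(* The bound is floor((m+n)/2), exactly the increment from g(m+n-1) to g(m+n). *)
have : minn m n <= uphalf (m + n - 1) by lia.
have : 0 < minn m' n' by rewrite leq_min m'0.
lia.
Qed.

Lemma F_nat_inj {m n m' n' : nat} : 0 < m -> 0 < n -> 0 < m' -> 0 < n' ->
  F_nat m n = F_nat m' n' -> m = m' /\ n = n' \/ m = n' /\ n = m'.
Proof.
move=> m0 n0 m'0 n'0 eqF.
have eq_sum : m + n = m' + n'.
  case: (ltngtP (m + n) (m' + n')) => // [lt_sum | lt_sum].
  - by have := F_nat_lt m0 m'0 n'0 lt_sum; rewrite eqF ltnn.
  - by have := F_nat_lt m'0 m0 n0 lt_sum; rewrite eqF ltnn.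
(* Equal sums make the product terms cancel, leaving equal minima. *)
by move: eqF; rewrite !F_natE eq_sum => /addnI; lia.
Qed.

Theorem theorem4 (x1 y1 x2 y2 : posint) (h : (x1, y1) <> (x2, y2)) :
  ((x1, y1) = (y2, x2) -> F x1 y1 = F x2 y2) /\
  ((x1, y1) <> (y2, x2) -> F x1 y1 <> F x2 y2).
Proof.
split=> [[-> ->] | hswap eqF].
  by apply: val_inj; exact: F_natC.
have /= := congr1 val eqF.
case/(F_nat_inj (valP x1) (valP y1) (valP x2) (valP y2)).
- by case=> /val_inj ex /val_inj ey; apply: h; rewrite ex ey.
- by case=> /val_inj ex /val_inj ey; apply: hswap; rewrite ex ey.
Qed.
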